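(* For any $F\subset\mathbb{R}^d$, we have $$\dim_P F=\overline{\dim}_{MGB} F.$$
   Context: For a nonempty bounded set $E\subset\mathbb{R}^d$ and $\delta>0$, $N_\delta(E)$ denotes the smallest number of closed balls of radius $\delta$ needed to cover $E$. $B(x,R)=\{y\in\mathbb{R}^d:\|y-x\|\le R\}$ is the closed Euclidean ball. For $\theta\in(0,1)$ and $F\subset\mathbb{R}^d$ (bounded or not), the Assouad spectrum is $\dim_A^\theta F:=\inf\{s\ge 0:$ there exists a constant $C>0$ such that for all $0<r=R^{1/\theta}<R<1$ and all $x\in F$, $N_r(B(x,R)\cap F)\le C(R/r)^s\}$, with $\dim_A^\theta\emptyset:=0$. The generalized upper box dimension of any $F\subset\mathbb{R}^d$ is $\overline{\dim}_{GB}F:=\limsup_{\theta\to 0}\dim_A^\theta F$ (with $\theta\to0$ through $(0,1)$). The modified generalized upper box dimension of $F\subset\mathbb{R}^d$ is $$\overline{\dim}_{MGB} F:=\inf\Big\{\sup_{i\ge 1}\overline{\dim}_{GB}F_i:\ F\subset\bigcup_{i=1}^{\infty}F_i\Big\},$$ the infimum being over all sequences $(F_i)_{i\ge1}$ of (not necessarily bounded) subsets of $\mathbb{R}^d$ covering $F$. Packing dimension: for $F\subset\mathbb{R}^d$, $s\ge0$, $\delta>0$, let $\mathcal{P}^s_\delta(F):=\sup\{\sum_i |B_i|^s\}$, the supremum over at most countable collections $\{B_i\}$ of disjoint closed balls of (positive) radii at most $\delta$ with centres in $F$, where $|B_i|$ is the diameter; let $\mathcal{P}^s_0(F):=\lim_{\delta\to0}\mathcal{P}^s_\delta(F)$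 and $\mathcal{P}^s(F):=\inf\{\sum_{i=1}^\infty\mathcal{P}^s_0(F_i): F\subset\bigcup_{i=1}^\infty F_i\}$. Then $\dim_P F:=\inf\{s\ge0:\mathcal{P}^s(F)=0\}$, with $\dim_P\emptyset:=0$. *)

(* Defs.v *)
From HB Require Import structures.
From mathcomp Require Import all_boot all_order all_algebra.
From mathcomp Require Import all_classical all_reals all_analysis.
Set Implicit Arguments.
Unset Strict Implicit.
Unset Printing Implicit Defensive.
Import Order.TTheory GRing.Theory Num.Theory.
Import numFieldNormedType.Exports.
Local Open Scope classical_set_scope.
Local Open Scope ring_scope.

Section Euclidean.
Variables (R : realType) (d : nat).
Implicit Types (x y : 'rV[R]_d) (E B F : set 'rV[R]_d).

(* The library norm `|x| on 'rV[R]_d is the sup norm, hence this one. *)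
Definition enorm x : R := Num.sqrt (\sum_(i < d) x ord0 i ^+ 2).

Definition ecball x (r : R) : set 'rV[R]_d := [set y | enorm (y - x) <= r].

Definition ediam B : R := sup [set enorm (x - y) | x in B & y in B].

(* The centres are arbitrary points; the value is +oo if no finite cover
   exists, and otherwise the infimum is a minimum. *)
Definition covering_number (delta : R) E : \bar R :=
  ereal_inf [set (n%:R : R)%:E | n in
    [set n : nat | exists c : 'I_n -> 'rV[R]_d,
       E `<=` \bigcup_i ecball (c i) delta]].

(* Only theta in (0, 1) is meaningful. *)
Definition assouad_spectrum (theta : R) F : \bar R :=
  ereal_inf [set s%:E | s in [set s : R | 0 <= s /\
    exists C : R, 0 < C /\
      forall r rho : R, 0 < r -> r = rho `^ theta^-1 -> r < rho -> rho < 1 ->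
      forall x, F x ->
        (covering_number r (ecball x rho `&` F) <=
         (C * (rho / r) `^ s)%:E)%E]].

Definition gen_upper_box_dim F : \bar R :=
  limf_esup (fun theta : R => assouad_spectrum theta F) (0 : R)^'+.

Definition mod_gen_upper_box_dim F : \bar R :=
  ereal_inf [set ereal_sup (range (fun i => gen_upper_box_dim (G i))) | G in
    [set G : (set 'rV[R]_d)^nat | F `<=` \bigcup_i G i]].

(* A family of disjoint nonempty sets has no repetition, so it is encoded as a
   set of balls. *)
Definition ball_packing (delta : R) F (P : set (set 'rV[R]_d)) : Prop :=
  [/\ countable P,
      trivIset P id &
      forall B, P B ->
        exists x (r : R), [/\ F x, 0 < r, r <= delta & B = ecball x r]].

Definition packing_delta (s delta : R) F : \bar R :=
  ereal_sup [set \esum_(B in P) (ediam B `^ s)%:E | P in ball_packing delta F].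

Definition packing_premeasure (s : R) F : \bar R :=
  lim (packing_delta s delta F @[delta --> (0 : R)^'+]).

Definition packing_measure (s : R) F : \bar R :=
  ereal_inf [set (\sum_(0 <= i <oo) packing_premeasure s (G i))%E | G in
    [set G : (set 'rV[R]_d)^nat | F `<=` \bigcup_i G i]].

Definition packing_dim F : \bar R :=
  ereal_inf [set s%:E | s in
    [set s : R | 0 <= s /\ packing_measure s F = 0%E]].

End Euclidean.

(* Main.v *)
Require Import Defs.
From mathcomp Require Import all_boot all_order all_algebra.
From mathcomp Require Import all_classical all_reals all_analysis.
From mathcomp Require Import finmap ring lra.
Set Implicit Arguments.
Unset Strict Implicit.
Unset Printing Implicit Defensive.
Import Order.TTheory GRing.Theory Num.Theory.
Import numFieldNormedType.Exports.
Local Open Scope classical_set_scope.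
Local Open Scope ring_scope.

(** Both dimensions are countably stabilized versions of the growth exponent of
    covering numbers, and two comparisons connect them.

    Packing dimension <= modified generalized upper box dimension. Suppose that
    the generalized upper box dimension of F is less than s, and let E be a
    bounded subset of F. For small theta, cut E into at most a constant times
    [r `^ (- theta * d)] pieces of diameter [r `^ theta], with a cubic grid, and
    cover each piece by balls of radius r thanks to the Assouad spectrum of F.
    As theta is small, the exponent obtained for the covering number of E stays
    below s ([assouad_spectrum_covered]). In a packing of E by disjoint balls,
    those with radii between [2 ^- k.+1] and [2 ^- k] have centres in different
    balls of a covering of E at scale [2 ^- k.+2], so that a geometric series
    bounds the packing sums of exponent s, and the s-dimensional packing
    premeasure of E is zero ([covered_packing_premeasure0]). An arbitrary set is
    a countable union of bounded sets, so packing measures vanish as well.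

    Conversely, if the s-dimensional packing measure of F is zero then F has a
    countable cover by sets E of finite s-dimensional packing premeasure. The
    balls of radius eta centred at a maximal 2 * eta-separated subset of E form
    a packing, hence a bound of order [eta `^ (- s)] on their number, while the
    concentric balls of radius 2 * eta cover E ([packing_delta_covered]). For
    [r = rho `^ theta^-1] one has [rho / r = r `^ (theta - 1)], whence the
    Assouad spectrum of E at theta is at most [s / (1 - theta)], which tends to
    s as theta tends to 0 ([covered_gen_upper_box_dim]). *)

(** * Euclidean norm and balls *)

Section EuclideanGeometry.
Variables (R : realType) (d : nat).
Implicit Types (x y z : 'rV[R]_d) (r : R).

Lemma enorm_ge0 x : 0 <= enorm x.
Proof. exact: sqrtr_ge0. Qed.

Lemma sqr_enorm x : enorm x ^+ 2 = \sum_(i < d) x ord0 i ^+ 2.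
Proof. by rewrite /enorm sqr_sqrtr// sumr_ge0// => i _; exact: sqr_ge0. Qed.

Lemma enorm0 : enorm (0 : 'rV[R]_d) = 0.
Proof.
rewrite /enorm big1 ?sqrtr0// => i _.
by rewrite mxE expr0n.
Qed.

Lemma enormN x : enorm (- x) = enorm x.
Proof.
by rewrite /enorm; congr Num.sqrt; apply: eq_bigr => i _; rewrite mxE sqrrN.
Qed.

Lemma enorm_dist x y : enorm (x - y) = enorm (y - x).
Proof. by rewrite -enormN opprB. Qed.

Lemma enorm_eq0 x : enorm x = 0 -> x = 0.
Proof.
move=> x0; have : \sum_(i < d) x ord0 i ^+ 2 == 0.
  by rewrite -sqr_enorm x0 expr0n.
rewrite psumr_eq0; last by move=> i _; exact: sqr_ge0.
move=> /allP xi0; apply/rowP => i; rewrite mxE; apply/eqP.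
by rewrite -sqrf_eq0; exact: xi0 (mem_index_enum i).
Qed.

Lemma ler_enormD x y : enorm (x + y) <= enorm x + enorm y.
Proof.
have [x0|x0] := eqVneq (enorm x) 0.
  by rewrite (enorm_eq0 x0) enorm0 !add0r.
have [y0|y0] := eqVneq (enorm y) 0.
  by rewrite (enorm_eq0 y0) enorm0 !addr0.
have a0 : 0 < enorm x by rewrite lt_def x0 enorm_ge0.
have b0 : 0 < enorm y by rewrite lt_def y0 enorm_ge0.
rewrite -(@ler_pXn2r _ 2)// ?nnegrE ?addr_ge0 ?enorm_ge0//.
rewrite sqr_enorm; set a := enorm x in x0 a0 *; set b := enorm y in y0 b0 *.
(* Coordinatewise arithmetic-geometric mean inequality, weighted by b / a. *)
pose t := b / a; have t0 : 0 < t by rewrite divr_gt0.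
have H i : (x + y) ord0 i ^+ 2 <=
    (1 + t) * x ord0 i ^+ 2 + (1 + t^-1) * y ord0 i ^+ 2.
  rewrite mxE -subr_ge0.
  have -> : (1 + t) * x ord0 i ^+ 2 + (1 + t^-1) * y ord0 i ^+ 2 -
     (x ord0 i + y ord0 i) ^+ 2 = t^-1 * (t * x ord0 i - y ord0 i) ^+ 2.
    by field; rewrite gt_eqF.
  by rewrite mulr_ge0 ?invr_ge0 ?sqr_ge0 ?ltW.
apply: (le_trans (ler_sum _ (fun i _ => H i))).
rewrite big_split /= -!mulr_sumr -!sqr_enorm -/a -/b le_eqVlt.
by apply/orP; left; apply/eqP; rewrite /t; field; rewrite x0.
Qed.

Lemma ler_enorm_dist x y z : enorm (x - z) <= enorm (x - y) + enorm (y - z).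
Proof.
have -> : x - z = (x - y) + (y - z) by rewrite addrA subrK.
exact: ler_enormD.
Qed.

(** The Euclidean norm is at most d times the sup norm. *)
Lemma enorm_le_coord x (h : R) : 0 <= h ->
  (forall i, `|x ord0 i| <= h) -> enorm x <= d%:R * h.
Proof.
move=> h0 xh; rewrite -(@ler_pXn2r _ 2)// ?nnegrE ?enorm_ge0 ?mulr_ge0//.
rewrite sqr_enorm (@le_trans _ _ (\sum_(i < d) h ^+ 2))//.
  apply: ler_sum => i _; rewrite -[leLHS]real_normK ?num_real//.
  by rewrite ler_pXn2r ?nnegrE.
rewrite sumr_const card_ord -[leLHS]mulr_natl exprMn ler_wpM2r ?sqr_ge0//.
by rewrite -natrX ler_nat -mulnn; case: (d) => // n; rewrite leq_pmulr.
Qed.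

Lemma coord_le_enorm x i : `|x ord0 i| <= enorm x.
Proof.
rewrite -(@ler_pXn2r _ 2)// ?nnegrE ?enorm_ge0// real_normK ?num_real//.
rewrite sqr_enorm (bigD1 i)//= lerDl sumr_ge0// => j _; exact: sqr_ge0.
Qed.

Lemma ecball_center x r : 0 <= r -> ecball x r x.
Proof. by rewrite /ecball/= subrr enorm0. Qed.

Lemma ecball_sym x y r : ecball x r y = ecball y r x.
Proof. by rewrite /ecball/= enorm_dist. Qed.

Lemma ecballD x y z (r1 r2 : R) :
  ecball x r1 y -> ecball y r2 z -> ecball x (r1 + r2) z.
Proof.
rewrite /ecball/= => xy yz; rewrite [r1 + _]addrC.
exact: (le_trans (ler_enorm_dist z y x) (lerD yz xy)).
Qed.

Lemma ecball_dist x y z r :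
  ecball x r y -> ecball x r z -> enorm (y - z) <= 2 * r.
Proof.
move=> xy xz; rewrite mulr_natl mulr2n.
by apply: (@ecballD z x y r r) => //; rewrite ecball_sym.
Qed.

Lemma ediam_ecball_le x r : 0 <= r -> ediam (ecball x r) <= 2 * r.
Proof.
move=> r0; have xx := ecball_center x r0.
apply: ge_sup; first by exists (enorm (x - x)), x => //; exists x.
by move=> _ [y xy] [z xz] <-; exact: ecball_dist xy xz.
Qed.

Lemma dist_le_ediam x y z r :
  ecball x r y -> ecball x r z -> enorm (y - z) <= ediam (ecball x r).
Proof.
move=> xy xz; apply: ub_le_sup; last by exists y => //; exists z.
by exists (2 * r) => _ [u xu] [v xv] <-; exact: ecball_dist xu xv.
Qed.

Lemma ediam_ecball_ge0 x r : 0 <= r -> 0 <= ediam (ecball x r).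
Proof.
move=> r0; have xx := ecball_center x r0.
exact: le_trans (enorm_ge0 (x - x)) (dist_le_ediam xx xx).
Qed.

(** In dimension 0 every ball has diameter 0, hence the hypothesis on d. *)
Lemma ediam_ecball x r : (0 < d)%N -> 0 <= r -> ediam (ecball x r) = 2 * r.
Proof.
move=> d0 r0; apply/eqP; rewrite eq_le ediam_ecball_le//=.
pose e : 'rV[R]_d := r *: delta_mx ord0 (Ordinal d0).
have enormZe (a : R) : enorm (a *: e) = `|a| * r.
  rewrite /enorm (bigD1 (Ordinal d0))//= big1 ?addr0; last first.
    by move=> i i0; rewrite !mxE eqxx (negbTE i0) !mulr0 expr0n.
  by rewrite !mxE !eqxx mulr1 sqrtr_sqr normrM (ger0_norm r0).
have xe : ecball x r (x + e).
  by rewrite /ecball/= addrAC subrr add0r -[e]scale1r enormZe normr1 mul1r.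
have xNe : ecball x r (x - e).
  by rewrite /ecball/= addrAC subrr add0r -scaleN1r enormZe normrN1 mul1r.
apply: le_trans (dist_le_ediam xe xNe).
have -> : x + e - (x - e) = 2 *: e.
  by rewrite opprB addrC addrA subrK scaler_nat mulr2n.
by rewrite enormZe ger0_norm.
Qed.

End EuclideanGeometry.

(** * Real powers with base less than 1 *)

Section PowerFunction.
Variable R : realType.
Implicit Types a x y : R.

Lemma powR_lt1 a x : 0 < a -> a < 1 -> 0 < x -> a `^ x < 1.
Proof.
move=> a0 a1 x0; have := @gt0_ltr_powR _ x x0 a 1.
by rewrite powR1 !nnegrE ltW//; exact.
Qed.

Lemma gt1_powR a x y : 0 < a -> a < 1 -> x < y -> a `^ y < a `^ x.
Proof.
move=> a0 a1 xy; have -> : y = x + (y - x) by rewrite addrC subrK.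
rewrite powRD; last by rewrite (gt_eqF a0) implybT.
by rewrite gtr_pMr ?powR_gt0// powR_lt1// subr_gt0.
Qed.

End PowerFunction.

(** * Covering numbers and the Assouad spectrum *)

Section Covering.
Variables (R : realType) (d : nat).
Implicit Types (x y z : 'rV[R]_d) (r : R) (E F : set 'rV[R]_d) (n m : nat).

(** The set E is covered by n closed balls of radius r, repetitions allowed. *)
Definition covered n r E :=
  exists c : 'I_n -> 'rV[R]_d, E `<=` \bigcup_i ecball (c i) r.

Lemma covered_finType (T : finType) (c : T -> 'rV[R]_d) r E :
  E `<=` \bigcup_t ecball (c t) r -> covered #|T| r E.
Proof.
move=> Ec; exists (c \o enum_val) => x /Ec[t _ xt].
by exists (enum_rank t) => //=; rewrite enum_rankK.
Qed.

Lemma covered_leq n m r E : (n <= m)%N -> covered n r E -> covered m r E.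
Proof.
move=> nm [c Ec]; exists (fun i => if insub (val i) is Some j then c j else 0).
move=> x /Ec[i _ xi]; exists (widen_ord nm i) => //=.
by case: insubP => [j _ /val_inj ->//|]; rewrite ltn_ord.
Qed.

Lemma subset_covered n r E F : E `<=` F -> covered n r F -> covered n r E.
Proof. by move=> EF [c Fc]; exists c; exact: subset_trans Fc. Qed.

Lemma covered_bigcup n m r (E_ : 'I_m -> set 'rV[R]_d) :
  (forall i, covered n r (E_ i)) -> covered (m * n) r (\bigcup_i E_ i).
Proof.
move=> /choice[c Ec].
have -> : (m * n)%N = #|{: 'I_m * 'I_n}| by rewrite card_prod !card_ord.
apply: (@covered_finType _ (fun p => c p.1 p.2)) => x [i _ /Ec[j _ xij]].
by exists (i, j).
Qed.

Lemma covering_number_le n r E :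
  covered n r E -> (covering_number r E <= n%:R%:E)%E.
Proof. by move=> En; apply: ereal_inf_lbound; exists n. Qed.

Lemma covered_le_number r E (a : R) :
  (covering_number r E <= a%:E)%E -> covered (Num.truncn a).+1 r E.
Proof.
move=> Ea; have : (covering_number r E < (Num.truncn a).+1%:R%:E)%E.
  by apply: (le_lt_trans Ea); rewrite lte_fin truncnS_gt.
move=> /ereal_inf_lt[_ [n En <-]]; rewrite lte_fin ltr_nat => na.
exact: covered_leq (ltnW na) En.
Qed.

Lemma assouad_spectrum_ge0 (theta : R) F : (0 <= assouad_spectrum theta F)%E.
Proof. by apply: le_ereal_inf_tmp => _ [s [s0 _] <-]; rewrite lee_fin. Qed.

(** The cells of a cubic grid of mesh rho / d.+1 have diameter at most rho. *)
Lemma bounded_partition (a : R) : 0 < a -> exists2 C : R, 0 < C &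
  forall rho, 0 < rho -> rho <= 1 -> exists m (E_ : 'I_m -> set 'rV[R]_d),
    [/\ m%:R <= C * rho `^ (- d%:R), ecball 0 a `<=` \bigcup_i E_ i &
        forall i x y, E_ i x -> E_ i y -> enorm (x - y) <= rho].
Proof.
move=> a0; pose C : R := 2 * a * d.+1%:R + 1.
have C0 : 0 < C by rewrite addr_gt0// !mulr_gt0.
exists (C ^+ d) => [|rho rho0 rho1]; first exact: exprn_gt0.
pose h := rho / d.+1%:R; have h0 : 0 < h by rewrite divr_gt0.
pose k := (Num.truncn (2 * a / h)).+1.
pose cell x :=
  [ffun i : 'I_d => inord (Num.truncn ((x ord0 i + a) / h)) : 'I_k].
pose T := {ffun 'I_d -> 'I_k}.
exists #|{: T}|, (fun i => ecball 0 a `&` [set x | cell x = enum_val i]).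
have coord x i : ecball 0 a x -> 0 <= (x ord0 i + a) / h <= 2 * a / h.
  rewrite /ecball/= subr0 => xa.
  have := le_trans (coord_le_enorm x i) xa; rewrite ler_norml => /andP[ax xa'].
  apply/andP; split; first by rewrite divr_ge0 ?(ltW h0)//; lra.
  by rewrite ler_pM2r ?invr_gt0//; lra.
split.
- rewrite card_ffun !card_ord natrX powRN powR_mulrn ?(ltW rho0)//.
  rewrite -exprVn -exprMn lerXn2r ?nnegrE//.
    by rewrite mulr_ge0 ?invr_ge0 ?(ltW C0) ?(ltW rho0).
  rewrite /k -natr1 (@le_trans _ _ (2 * a / h + 1))//.
    by rewrite lerD2r truncn_le divr_ge0 ?(ltW h0)// mulr_ge0// ltW.
  rewrite /h invfM invrK /C [leRHS]mulrDl mul1r lerD ?invf_ge1//.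
  by rewrite mulrA mulrAC.
- move=> x xa; exists (enum_rank (cell x)) => //=.
  by split => //; rewrite enum_rankK.
move=> i x y [xa xi] [ya yi].
have -> : rho = d.+1%:R * h by rewrite mulrC divfK.
rewrite (@le_trans _ _ (d%:R * h))//; last by rewrite ler_pM2r// ler_nat.
apply: enorm_le_coord => [|j]; first exact: ltW.
have : cell x j = cell y j by rewrite xi yi.
rewrite !ffunE => /(congr1 val) /=.
have bnd z : ecball 0 a z -> (Num.truncn ((z ord0 j + a) / h) < k)%N.
  by move=> za; have /andP[_ ?] := coord _ j za; rewrite /k ltnS le_truncn.
rewrite !inordK ?bnd//.
have /andP[/truncn_itv/andP[x1 x2] _] := coord _ j xa.
have /andP[/truncn_itv/andP[y1 y2] _] := coord _ j ya.
move=> xy; rewrite xy in x1 x2.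
have -> : (x - y) ord0 j = ((x ord0 j + a) / h - (y ord0 j + a) / h) * h.
  by rewrite !mxE; field; rewrite gt_eqF.
rewrite normrM (gtr0_norm h0) ler_piMl ?ltW// ltr_norml.
by move: x1 x2 y1 y2; rewrite -natr1; lra.
Qed.

(** A bounded piece E of F is cut into about r `^ (- theta * d) pieces of
    diameter r `^ theta, each of which is covered thanks to the Assouad
    spectrum of F; the first factor becomes harmless for small theta. *)
Lemma assouad_spectrum_covered (theta s a : R) E F :
  0 < theta -> theta < 1 -> 0 < a -> E `<=` F -> E `<=` ecball 0 a ->
  (assouad_spectrum theta F < s%:E)%E ->
  exists2 C : R, 0 < C & forall r, 0 < r -> r < 1 ->
    exists n, n%:R <= C * r `^ (- (s + theta * d%:R)) /\ covered n r E.
Proof.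
move=> t0 t1 a0 EF Ea /ereal_inf_lt[_ [u [u0 [C [C0 FC]]] <-]].
rewrite lte_fin => us.
have [D D0 ED] := bounded_partition a0.
(* C + 1 instead of C absorbs the rounding of covering numbers to integers. *)
exists (D * (C + 1)) => [|r r0 r1]; first by rewrite mulr_gt0// addr_gt0.
pose rho := r `^ theta.
have rho0 : 0 < rho by exact: powR_gt0.
have rho1 : rho < 1 by exact: powR_lt1.
have rE : r = rho `^ theta^-1 by rewrite -powRrM divff ?gt_eqF// powRr1// ltW.
have r_rho : r < rho by rewrite -{1}[r]powRr1 ?ltW// gt1_powR.
have [m [E_ [mD aE Erho]]] := ED rho rho0 (ltW rho1).
pose b := C * (rho / r) `^ u.
exists (m * (Num.truncn b).+1)%N; split; last first.
  apply: (@subset_covered _ _ _ (\bigcup_i (E_ i `&` E))).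
    by move=> x Ex; have [i _ xi] := aE x (Ea x Ex); exists i.
  apply: covered_bigcup => i.
  have [[x [xi Ex]]|Ei0] := pselect (exists x, (E_ i `&` E) x); last first.
    apply: (@covered_leq 0%N) => //; exists (fun=> 0) => y Ey.
    by case: Ei0; exists y.
  apply: (@subset_covered _ _ _ (ecball x rho `&` F)) => [y [yi Ey]|].
    by split; [exact: Erho yi xi|exact: EF].
  by apply: covered_le_number; exact: FC (EF _ Ex).
have rhor : rho / r = r `^ (theta - 1).
  by rewrite powRB ?(gt_eqF r0) ?implybT// powRr1 ?(ltW r0).
have b1 : b = C * r `^ (- ((1 - theta) * u)).
  by rewrite /b rhor -powRrM; congr (_ * _ `^ _); ring.
have rge1 (v : R) : 0 <= v -> 1 <= r `^ (- v).
  move=> v0; rewrite powRN invf_ge1 ?powR_gt0//.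
  by rewrite -(powRr0 r) ger_powR// r0 ltW.
rewrite natrM (@le_trans _ _ (D * rho `^ (- d%:R) * ((C + 1) * r `^ (- s))))//.
  rewrite ler_pM// -natr1 mulrDl mul1r lerD//.
    rewrite (@le_trans _ _ b) ?truncn_le//.
      by rewrite /b mulr_ge0 ?powR_ge0// ltW.
    rewrite b1 ler_pM2l// ger_powR ?r0 ?(ltW r1)//.
    rewrite lerN2 (@le_trans _ _ u) ?(ltW us)//.
    by rewrite ler_piMl// gerBl ltW.
  by apply: rge1; rewrite (le_trans u0) ?ltW.
rewrite /rho -powRrM mulrACA ler_pM2l ?mulr_gt0 ?addr_gt0//.
rewrite -powRD ?(gt_eqF r0) ?implybT//.
by rewrite mulrN -opprD addrC.
Qed.

End Covering.

(** * Packing premeasures *)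

Section PackingPremeasure.
Variables (R : realType) (d : nat).
Implicit Types (E F : set 'rV[R]_d) (s delta : R).

Lemma packing_delta_ge0 s delta F : (0 <= packing_delta s delta F)%E.
Proof.
apply: ereal_sup_ubound; exists set0; last by rewrite esum_set0.
by split => //; exact: trivIset_set0.
Qed.

Lemma le_packing_delta s F :
  {homo packing_delta s ^~ F : x y / x <= y >-> (x <= y)%E}.
Proof.
move=> x y xy; apply: ge_ereal_sup => _ [P [cP tP PF] <-].
apply: ereal_sup_ubound; exists P => //; split => // B /PF[c [r [Fc r0 rx ->]]].
by exists c, r; split => //; exact: le_trans xy.
Qed.

Lemma packing_premeasureE s F : packing_premeasure s F =
  ereal_inf [set packing_delta s delta F | delta in [set` `]0, +oo[]].
Proof.
apply: cvg_lim => //; apply: nondecreasing_at_right_cvge => //.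
by move=> x y _ _; exact: le_packing_delta.
Qed.

Lemma packing_premeasure_ge0 s F : (0 <= packing_premeasure s F)%E.
Proof.
rewrite packing_premeasureE; apply: le_ereal_inf_tmp => _ [delta _ <-].
exact: packing_delta_ge0.
Qed.

Lemma packing_premeasure_le s delta F : 0 < delta ->
  (packing_premeasure s F <= packing_delta s delta F)%E.
Proof.
move=> delta0; rewrite packing_premeasureE; apply: ereal_inf_lbound.
by exists delta => //=; rewrite in_itv/= delta0.
Qed.

Lemma packing_premeasure_lt s F (x : \bar R) : (packing_premeasure s F < x)%E ->
  exists2 delta, 0 < delta & (packing_delta s delta F < x)%E.
Proof.
rewrite packing_premeasureE => /ereal_inf_lt[_ [delta + <-] Fx].
by rewrite /= in_itv/= andbT => delta0; exists delta.
Qed.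

Lemma packing_measure_ge0 s F : (0 <= packing_measure s F)%E.
Proof.
apply: le_ereal_inf_tmp => _ [G _ <-]; apply: nneseries_ge0 => i _ _.
exact: packing_premeasure_ge0.
Qed.

End PackingPremeasure.

(** * From coverings to packings *)

Section PackingFromCovering.
Variables (R : realType) (d : nat).
Implicit Types (E F : set 'rV[R]_d) (s t u delta C : R).

Lemma dyadic_scale (r : R) : 0 < r -> r <= 1 ->
  exists k : nat, 2^-1 ^+ k.+1 < r /\ r <= 2^-1 ^+ k.
Proof.
move=> r0 r1; have exk : exists k, (2^-1 : R) ^+ k.+1 < r.
  exists (Num.bound r^-1); rewrite exprVn -[ltRHS]invrK.
  by rewrite ltf_pV2 ?posrE ?exprn_gt0 ?invr_gt0// upper_nthrootP.
case: (ex_minnP exk) => k kr kmin; exists k; split => //.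
case: k kr kmin => [|k] kr kmin; first by rewrite expr0.
by rewrite leNgt; apply/negP => /kmin; rewrite ltnn.
Qed.

Lemma geometric_sum_le (q : R) n : 0 <= q -> q < 1 ->
  \sum_(k < n) q ^+ k <= (1 - q)^-1.
Proof.
move=> q0 q1; have q10 : 0 < 1 - q by rewrite subr_gt0.
rewrite -(ler_pM2l q10) divff ?gt_eqF//.
have -> : (1 - q) * \sum_(k < n) q ^+ k = 1 - q ^+ n.
  by rewrite -[RHS]opprB subrX1 -mulNr opprB.
by rewrite gerBl exprn_ge0.
Qed.

(** Summation by classes: the function cl sorts the elements of X, b k bounds f
    on the k-th class and c k bounds the size of that class. *)
Lemma ler_sum_classes (T : eqType) (X : seq T) (cl : T -> nat) (f : T -> R)
    (b c : nat -> R) :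
  (forall x, x \in X -> f x <= b (cl x)) ->
  (forall k, 0 <= b k) ->
  (forall k, (size [seq x <- X | cl x == k])%:R <= c k) ->
  exists K, \sum_(x <- X) f x <= \sum_(k < K) c k * b k.
Proof.
move=> fb b0 Xc; pose K := (\max_(x <- X) cl x).+1; exists K.
apply: (@le_trans _ _ (\sum_(x <- X) \sum_(k < K) (cl x == k)%:R * b k)).
  rewrite big_seq [leRHS]big_seq; apply: ler_sum => x xX.
  have xK : (cl x < K)%N by rewrite /K ltnS; exact: leq_bigmax_seq.
  rewrite (bigD1 (Ordinal xK))//= eqxx mul1r (le_trans (fb x xX))// lerDl.
  by rewrite sumr_ge0// => k _; rewrite mulr_ge0.
rewrite exchange_big/=; apply: ler_sum => k _.
rewrite -mulr_suml; apply: ler_wpM2r => //; apply: le_trans (Xc k).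
rewrite -natr_sum size_filter -sum1_count [in leRHS]big_mkcond/= ler_nat.
by apply: leq_sum => x _; case: eqP.
Qed.

(** Disjoint balls of radii larger than 2 * eta have centres in different balls
    of a covering by balls of radius eta. *)
Lemma size_packing_le (n : nat) (eta : R) E (P : set (set 'rV[R]_d))
    (X : seq (set 'rV[R]_d)) (ctr : set 'rV[R]_d -> 'rV[R]_d)
    (rad : set 'rV[R]_d -> R) :
  uniq X -> trivIset P id -> covered n eta E ->
  (forall B, B \in X -> [/\ P B, E (ctr B), 2 * eta < rad B,
                         0 < rad B & B = ecball (ctr B) (rad B)]) ->
  (size X <= n)%N.
Proof.
move=> uX tP [c Ec] XP.
have /choice[g gP] (B : set 'rV[R]_d) : exists j : nat, B \in X ->
    exists2 i : 'I_n, val i = j & ecball (c i) eta (ctr B).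
  have [BX|BX] := boolP (B \in X); last by exists 0%N.
  have [_ EB _ _ _] := XP B BX.
  by have [i _ ciB] := Ec _ EB; exists (val i) => _; exists i.
rewrite -(size_map g) -[leqRHS](size_iota 0 n).
apply: uniq_leq_size; last first.
  by move=> _ /mapP[B /gP[i <- _] ->]; rewrite mem_iota/=.
rewrite map_inj_in_uniq// => A B AX BX.
have [i giA iA] := gP A AX; have [j gjB jB] := gP B BX.
rewrite -giA -gjB => /val_inj ij; rewrite -ij in jB.
have [PA _ _ A0 Aball] := XP A AX; have [PB _ etaB _ Bball] := XP B BX.
apply: (tP A B PA PB); exists (ctr A); split.
  by have := ecball_center (ctr A) (ltW A0); rewrite -Aball.
have : ecball (ctr B) (rad B) (ctr A); last by rewrite -Bball.
by rewrite /ecball/=; apply: le_trans (ltW etaB); exact: ecball_dist iA jB.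
Qed.

(** The box dimension controls packings: the balls of a packing with radii
    about 2 ^- k are at most about 2 ^+ (k * u) in number, and the resulting
    geometric series converges since u < t. Half of the gap between u and t
    is kept to obtain a bound that vanishes with delta. *)
Lemma covered_packing_delta E u t C :
  0 <= u -> u < t -> 0 < C ->
  (forall r, 0 < r -> r < 1 ->
    exists n, n%:R <= C * r `^ (- u) /\ covered n r E) ->
  exists M, forall delta, 0 < delta -> delta <= 1 ->
    (packing_delta t delta E <= ((2 * delta) `^ ((t - u) / 2) * M)%:E)%E.
Proof.
move=> u0 ut C0 EC; pose e := (t - u) / 2; pose v := u + e.
have e0 : 0 < e by rewrite divr_gt0// subr_gt0.
have v0 : 0 <= v by rewrite addr_ge0// ltW.
have tE : t = v + e by rewrite /v /e; field.
pose w : R := 2^-1; have w0 : 0 < w by rewrite invr_gt0.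
have w1 : w < 1 by rewrite invf_lt1// ltr1n.
pose q := w `^ e.
exists (C * (w ^+ 2) `^ (- u) * 2 `^ v * (1 - q)^-1) => delta delta0 delta1.
apply: ge_ereal_sup => _ [P [_ tP PE] <-].
apply: ge_ereal_sup => _ [A [finA AP] <-].
rewrite fsbig_finite// sumEFin lee_fin -/e.
pose X := enum_fset (fset_set A); rewrite -/X.
have uX : uniq X by exact: fset_uniq.
have XP B : B \in X -> P B by rewrite in_fset_set// => /set_mem /AP.
(* A ball may have several centres and radii (when d = 0): cr fixes a choice. *)
have /choice[cr crP] (B : set 'rV[R]_d) : exists cr : 'rV[R]_d * R, P B ->
    [/\ E cr.1, 0 < cr.2, cr.2 <= delta & B = ecball cr.1 cr.2].
  have [/PE[c [r cr]]|nPB] := pselect (P B); first by exists (c, r).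
  by exists (0, 0).
have /choice[cl clP] (B : set 'rV[R]_d) : exists k, P B ->
    w ^+ k.+1 < (cr B).2 /\ (cr B).2 <= w ^+ k.
  have [/crP[_ r0 rdelta _]|nPB] := pselect (P B); last by exists 0%N.
  by have [k kr] := dyadic_scale r0 (le_trans rdelta delta1); exists k.
(* The balls B of the packing with cl B = k have radius more than w ^+ k.+1, so
   they are counted by a covering at scale w ^+ k.+2. *)
have [|||K] := @ler_sum_classes _ X cl (fun B => ediam B `^ t)
  (fun k => (2 * delta) `^ e * (2 * w ^+ k) `^ v)
  (fun k => C * (w ^+ k.+2) `^ (- u)).
- move=> B /XP PB; have [_ r0 rdelta BE] := crP B PB.
  have [_ rk] := clP B PB.
  have := ediam_ecball_ge0 (cr B).1 (ltW r0); rewrite -BE => B0.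
  have := ediam_ecball_le (cr B).1 (ltW r0); rewrite -BE => Br.
  rewrite tE addrC powRD; last first.
    by apply/implyP; rewrite gt_eqF// ltr_wpDr.
  rewrite ler_pM ?powR_ge0//; apply: ge0_ler_powR; rewrite ?nnegrE ?(ltW e0)//.
  + by rewrite mulr_ge0// ltW.
  + by rewrite (le_trans Br)// ler_pM2l.
  + by rewrite mulr_ge0// exprn_ge0// ltW.
  + by rewrite (le_trans Br)// ler_pM2l.
- by move=> k; rewrite mulr_ge0 ?powR_ge0.
- move=> k; have [||n [nC En]] := EC (w ^+ k.+2).
  + exact: exprn_gt0.
  + by rewrite expr_lt1// ltW.
  apply: le_trans nC; rewrite ler_nat.
  apply: (@size_packing_le n (w ^+ k.+2) E P _ (fst \o cr) (snd \o cr)) => //.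
    by rewrite filter_uniq.
  move=> B; rewrite mem_filter => /andP[/eqP clB /XP PB].
  have [EB r0 _ BE] := crP B PB; split => //=.
  by rewrite exprS mulrA divff// mul1r -clB; have [] := clP B PB.
move=> /le_trans; apply.
have termE k : C * (w ^+ k.+2) `^ (- u) * ((2 * delta) `^ e * (2 * w ^+ k) `^ v)
    = (2 * delta) `^ e * (C * (w ^+ 2) `^ (- u) * 2 `^ v) * q ^+ k.
  have wk0 : 0 < w ^+ k by exact: exprn_gt0.
  have -> : q ^+ k = (w ^+ k) `^ (- u) * (w ^+ k) `^ v.
    rewrite -powRD; last by rewrite (gt_eqF wk0) implybT.
    have -> : - u + v = e by rewrite /v addrA addNr add0r.
    rewrite -(powR_mulrn k (powR_ge0 w e)) -(powR_mulrn k (ltW w0)).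
    exact: powRAC.
  rewrite -addn2 exprD.
  rewrite ![(_ * _) `^ _]powRM ?exprn_ge0 ?(ltW w0) ?(ltW delta0)//.
  ring.
rewrite (eq_bigr _ (fun (k : 'I_K) _ => termE k)).
rewrite -mulr_sumr -mulrA ler_wpM2l ?powR_ge0//.
rewrite ler_wpM2l ?mulr_ge0 ?powR_ge0 ?(ltW C0)//.
by apply: geometric_sum_le; rewrite ?powR_ge0// powR_lt1.
Qed.

Lemma covered_packing_premeasure0 E u t C :
  0 <= u -> u < t -> 0 < C ->
  (forall r, 0 < r -> r < 1 ->
    exists n, n%:R <= C * r `^ (- u) /\ covered n r E) ->
  packing_premeasure t E = 0%E.
Proof.
move=> u0 ut C0 /(covered_packing_delta u0 ut C0)[M EM].
apply/eqP; rewrite eq_le packing_premeasure_ge0 andbT.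
set e := (t - u) / 2 in EM; have e0 : 0 < e by rewrite divr_gt0// subr_gt0.
pose N := `|M| + 1; have N0 : 0 < N by rewrite ltr_wpDl.
apply/lee_addgt0Pr => eps eps0; rewrite add0e.
(* The choice of delta makes (2 * delta) `^ e * N at most eps. *)
pose delta := Num.min 1 ((eps / N) `^ e^-1 / 2).
have delta0 : 0 < delta.
  by rewrite lt_min ltr01/= divr_gt0// powR_gt0// divr_gt0.
apply: (le_trans (packing_premeasure_le t E delta0)).
apply: (le_trans (EM delta delta0 _)); first by rewrite ge_min lexx.
rewrite lee_fin (@le_trans _ _ ((2 * delta) `^ e * N))//.
  by rewrite ler_wpM2l ?powR_ge0// (le_trans (ler_norm M))// lerDl.
rewrite -ler_pdivlMr//.
have -> : eps / N = ((eps / N) `^ e^-1) `^ e.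
  by rewrite -powRrM mulVf ?gt_eqF// powRr1// divr_ge0 ?ltW.
apply: ge0_ler_powR; rewrite ?nnegrE ?powR_ge0 ?(ltW e0)//.
  by rewrite mulr_ge0// ltW.
by rewrite mulrC -ler_pdivlMr// ge_min lexx orbT.
Qed.

End PackingFromCovering.

(** * From packings to coverings *)

Section CoveringFromPacking.
Variables (R : realType) (d : nat).
Implicit Types (x y : 'rV[R]_d) (E F : set 'rV[R]_d) (s delta eta : R).

(** A finite 2 * eta-separated family of points of E. *)
Definition separated eta E (X : seq 'rV[R]_d) := [/\ uniq X,
  forall x, x \in X -> E x &
  forall x y, x \in X -> y \in X -> x != y -> 2 * eta < enorm (x - y)].

(** The balls of radius eta around a 2 * eta-separated family form a packing.
    The diameters of its balls are 2 * eta, as 0 < d. *)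
Lemma separated_packing_delta s delta eta E X : (0 < d)%N ->
  0 < eta -> eta <= delta -> separated eta E X ->
  (((2 * eta) `^ s *+ size X)%:E <= packing_delta s delta E)%E.
Proof.
move=> d0 eta0 etadelta [uX XE Xsep].
have ball_inj x y z : x \in X -> y \in X ->
    ecball x eta z -> ecball y eta z -> x = y.
  move=> xX yX; rewrite ecball_sym => zx; rewrite ecball_sym => zy.
  apply/eqP; apply/negPn/negP => xy.
  by have := Xsep x y xX yX xy; rewrite ltNge (ecball_dist zx zy).
have Xinj : set_inj [set` X] (fun x => ecball x eta).
  move=> x y /set_mem/= xX /set_mem/= yX xy; apply: (@ball_inj x y x) => //.
    exact/ecball_center/ltW.
  by rewrite -xy; exact/ecball_center/ltW.
apply: ereal_sup_ubound; exists [set ecball x eta | x in [set` X]].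
  split.
  - apply: finite_set_countable; apply: finite_image; exact: finite_seq.
  - move=> _ _ [x xX <-] [y yX <-] [z [/= xz yz]].
    by rewrite (ball_inj x y z xX yX xz yz).
  - by move=> _ [x xX <-]; exists x, eta; split => //; exact: XE.
rewrite esum_image// esum_fset; first last.
- by move=> x _; rewrite lee_fin powR_ge0.
- exact: finite_seq.
rewrite -fsbig_seq// sumEFin; congr EFin.
under eq_bigr do rewrite ediam_ecball ?(ltW eta0)//.
by rewrite big_const_seq count_predT iter_addr_0.
Qed.

(** A separated family of maximal size is the set of centres of a covering. *)
Lemma maximal_separated_covered eta E N : 0 <= eta ->
  (forall X, separated eta E X -> (size X <= N)%N) ->
  exists X, separated eta E X /\ covered (size X) (2 * eta) E.
Proof.
move=> eta0 EN; pose P n := `[< exists2 X, separated eta E X & size X = n >].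
have exP : exists n, P n by exists 0%N; apply/asboolP; exists [::].
have ubP n : P n -> (n <= N)%N by move=> /asboolP[X /EN XN <-].
case: (ex_maxnP exP ubP) => n /asboolP[X sepX <-] maxX.
exists X; split => //; have [uX XE Xsep] := sepX.
exists (tnth (in_tuple X)) => y Ey; apply: contrapT => nXy.
have far x : x \in X -> 2 * eta < enorm (x - y).
  move=> xX; rewrite ltNge; apply/negP => xy; apply: nXy.
  have /tnthP[i xi] : x \in in_tuple X by [].
  by exists i => //; rewrite -xi /ecball/= enorm_dist.
have yX : y \notin X.
  apply/negP => /far; rewrite subrr enorm0 ltNge => /negP; apply.
  by rewrite mulr_ge0.
suff /maxX : P (size X).+1 by rewrite ltnn.
apply/asboolP; exists (y :: X) => //; split => /=; first by rewrite yX.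
- by move=> x; rewrite inE => /predU1P[->|/XE].
- move=> x z; rewrite !inE => /predU1P[->|xX] /predU1P[->|zX].
  + by rewrite eqxx.
  + by move=> _; rewrite enorm_dist; exact: far.
  + by move=> _; exact: far.
  + exact: Xsep.
Qed.

Lemma packing_delta_covered s delta E : 0 <= s -> 0 < delta ->
  (packing_delta s delta E < +oo)%E ->
  exists2 C : R, 0 < C & forall r, 0 < r -> r < 1 ->
    exists n, n%:R <= C * r `^ (- s) /\ covered n r E.
Proof.
move=> s0 delta0 Efin; have [d0|d0] := posnP d.
  (* A ball of the zero-dimensional space is the whole space. *)
  exists 1 => // r r0 r1; exists 1%N; split.
    by rewrite mul1r powRN invf_ge1 ?powR_gt0// -(powRr0 r) ger_powR// r0 ltW.
  exists (fun=> 0) => x _; exists ord0 => //.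
  rewrite /ecball/= (_ : x - 0 = 0) ?enorm0 ?ltW//.
  by apply/rowP => i; have := ltn_ord i; rewrite [X in (_ < X)%N]d0.
have [M EM] : exists M : R, packing_delta s delta E = M%:E.
  exists (fine (packing_delta s delta E)); rewrite fineK//.
  by rewrite ge0_fin_numE// packing_delta_ge0.
have M0 : 0 <= M by rewrite -lee_fin -EM packing_delta_ge0.
pose c := Num.min 1 (2 * delta).
have c0 : 0 < c by rewrite lt_min ltr01 mulr_gt0.
exists ((M + 1) * c `^ (- s)) => [|r r0 r1].
  by rewrite mulr_gt0 ?powR_gt0// ltr_wpDl.
(* This eta is at most both r / 2 and delta, and comparable to r. *)
pose eta := c * r / 2; have eta0 : 0 < eta by rewrite divr_gt0// mulr_gt0.
have eta2 : 2 * eta = c * r by rewrite /eta mulrC divfK.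
have eta_delta : eta <= delta.
  rewrite /eta ler_pdivrMr// [leRHS]mulrC (@le_trans _ _ c)//.
    by rewrite ler_piMr ?ltW.
  by rewrite ge_min lexx orbT.
have size_le X : separated eta E X -> (size X)%:R <= M * (2 * eta) `^ (- s).
  move=> /(separated_packing_delta s d0 eta0 eta_delta); rewrite EM lee_fin.
  rewrite powRN ler_pdivlMr ?powR_gt0 ?mulr_gt0//.
  by rewrite [X in _ -> X <= _]mulr_natl.
have [X sX|X [sepX EX]] := @maximal_separated_covered eta E
    (Num.truncn (M * (2 * eta) `^ (- s))) (ltW eta0).
  by rewrite truncn_ge_nat ?size_le// mulr_ge0 ?powR_ge0.
exists (size X); split.
  rewrite (le_trans (size_le X sepX))// eta2 powRM ?(ltW c0) ?(ltW r0)// mulrA.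
  by rewrite ler_wpM2r ?powR_ge0// ler_wpM2r ?powR_ge0// lerDl.
move: EX => [y Ey]; exists y => z /Ey[i _ yz]; exists i => //.
apply: le_trans yz _; rewrite eta2 ler_piMl ?(ltW r0)//.
by rewrite ge_min lexx.
Qed.

Lemma covered_assouad_spectrum s E C (theta : R) :
  0 <= s -> 0 < C -> 0 < theta -> theta < 1 ->
  (forall r, 0 < r -> r < 1 ->
    exists n, n%:R <= C * r `^ (- s) /\ covered n r E) ->
  (assouad_spectrum theta E <= (s / (1 - theta))%:E)%E.
Proof.
move=> s0 C0 t0 t1 EC; have t10 : 0 < 1 - theta by rewrite subr_gt0.
apply: ereal_inf_lbound; exists (s / (1 - theta)) => //.
split; first by rewrite divr_ge0// ltW.
exists C; split => // r rho r0 rE r_rho rho1 x _.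
have [n [nC En]] := EC r r0 (lt_trans r_rho rho1).
apply: (le_trans (covering_number_le (subset_covered (@subIsetr _ _ _) En))).
rewrite lee_fin (le_trans nC)// ler_pM2l// le_eqVlt; apply/orP; left; apply/eqP.
have rhoE : rho = r `^ theta.
  rewrite rE -powRrM mulVf ?gt_eqF// powRr1//.
  by rewrite ltW// (lt_trans r0).
have -> : rho / r = r `^ (theta - 1).
  by rewrite powRB ?(gt_eqF r0) ?implybT// powRr1 ?(ltW r0)// -rhoE.
by rewrite -powRrM; congr (_ `^ _); field; rewrite gt_eqF.
Qed.

Lemma covered_gen_upper_box_dim s E C : 0 <= s -> 0 < C ->
  (forall r, 0 < r -> r < 1 ->
    exists n, n%:R <= C * r `^ (- s) /\ covered n r E) ->
  (gen_upper_box_dim E <= s%:E)%E.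
Proof.
move=> s0 C0 EC; apply/lee_addgt0Pr => e e0.
have se0 : 0 < s + e by rewrite ltr_wpDl.
pose V : set R := [set theta | [/\ 0 < theta, theta < 1 & theta < e / (s + e)]].
apply: (@le_trans _ _ (ereal_sup [set assouad_spectrum theta E | theta in V])).
  apply: ereal_inf_lbound; exists V => //.
  have e_se : 0 < e / (s + e) by rewrite divr_gt0.
  near=> theta; split; near: theta.
  - exact: nbhs_right_gt.
  - exact: nbhs_right_lt.
  - exact: nbhs_right_lt.
apply: ge_ereal_sup => _ [theta [t0 t1 te] <-].
apply: (le_trans (covered_assouad_spectrum s0 C0 t0 t1 EC)).
rewrite -EFinD lee_fin ler_pdivrMr ?subr_gt0//.
by move: te; rewrite ltr_pdivlMr// => te; nra.
Unshelve. all: by end_near.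
Qed.

End CoveringFromPacking.

(** * Comparison of the two dimensions *)

Section Comparison.
Variables (R : realType) (d : nat).
Implicit Types (E F : set 'rV[R]_d) (s : R).

Lemma gen_upper_box_dim_ge0 F : (0 <= gen_upper_box_dim F)%E.
Proof.
apply: limf_esup_ge0 => [|theta]; last exact: assouad_spectrum_ge0.
exact: filter_not_empty.
Qed.

(** The limit superior is used only through one small value of theta. *)
Lemma gen_upper_box_dim_premeasure0 s (a : R) E F :
  0 < a -> E `<=` F -> E `<=` ecball 0 a -> (gen_upper_box_dim F < s%:E)%E ->
  packing_premeasure s E = 0%E.
Proof.
move=> a0 EF Ea /ereal_inf_lt[_ [V V0 <-]].
have Vsup (theta : R) : V theta ->
    (assouad_spectrum theta F <=
     ereal_sup [set assouad_spectrum t F | t in V])%E.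
  by move=> Vt; apply: ereal_sup_ubound; exists theta.
have [t0 /Vsup Vt0] := filter_ex V0.
move: (ereal_sup _) Vsup (le_trans (assouad_spectrum_ge0 _ _) Vt0) => [b||]//.
move=> Vsup; rewrite lee_fin => b0; rewrite lte_fin => bs.
(* An exponent s0 < s is fixed before theta, which must satisfy
   s0 + theta * d < s. *)
pose s0 := (b + s) / 2; have bs0 : b < s0 by rewrite midf_lt.
have s0s : s0 < s by rewrite midf_lt.
have : \forall theta \near (0 : R)^'+, [/\ V theta, 0 < theta, theta < 1 &
    theta < (s - s0) / d.+1%:R].
  near=> theta; split; near: theta => //.
  - exact: nbhs_right_gt.
  - exact: nbhs_right_lt.
  - by apply: nbhs_right_lt; rewrite divr_gt0// subr_gt0.
move=> /filter_ex[theta [Vt t0' t1 td]].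
have As0 : (assouad_spectrum theta F < s0%:E)%E.
  by apply: (le_lt_trans (Vsup _ Vt)); rewrite lte_fin.
have [C C0 EC] := assouad_spectrum_covered t0' t1 a0 EF Ea As0.
apply: covered_packing_premeasure0 C0 EC.
  by apply: addr_ge0; [exact: ltW (le_lt_trans b0 bs0)|rewrite mulr_ge0// ltW].
rewrite -ltrBrDl; move: td; rewrite ltr_pdivlMr// -natr1 mulrDr mulr1.
by apply: le_lt_trans; rewrite lerDl ltW.
Unshelve. all: by end_near.
Qed.

Lemma gen_upper_box_dim_packing_measure0 s F (G : (set 'rV[R]_d)^nat) :
  F `<=` \bigcup_i G i -> (forall i, gen_upper_box_dim (G i) < s%:E)%E ->
  packing_measure s F = 0%E.
Proof.
move=> FG Gs; apply/eqP; rewrite eq_le packing_measure_ge0 andbT.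
(* The sets H k enumerate the intersections of the G i with the balls of
   positive integer radius centred at 0. *)
pose idx (k : nat) : nat * nat := odflt (0, 0)%N (choice.unpickle k).
pose H k := G (idx k).1 `&` ecball 0 (idx k).2.+1%:R.
apply: ereal_inf_lbound; exists H.
  move=> x /FG[i _ xi]; exists (choice.pickle (i, Num.truncn (enorm x))) => //.
  rewrite /H /idx choice.pickleK/=; split => //.
  by rewrite /ecball/= subr0 ltW// truncnS_gt.
apply: eseries0 => k _ _.
apply: (@gen_upper_box_dim_premeasure0 s (idx k).2.+1%:R (H k)
  (G (idx k).1)) => //.
- exact: subIsetl.
- exact: subIsetr.
Qed.

Lemma packing_dim_le F : (packing_dim F <= mod_gen_upper_box_dim F)%E.
Proof.
apply: le_ereal_inf_tmp => _ [G FG <-]; set b := ereal_sup _.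
have Gb i : (gen_upper_box_dim (G i) <= b)%E.
  by apply: ereal_sup_ubound; exists i.
have := le_trans (gen_upper_box_dim_ge0 _) (Gb 0%N).
case: b Gb => [b||] Gb; [|by move=> _; rewrite leey|by []].
rewrite lee_fin => b0; apply/lee_addgt0Pr => e e0; rewrite -EFinD.
apply: ereal_inf_lbound; exists (b + e) => //; split.
  by rewrite addr_ge0// ltW.
apply: gen_upper_box_dim_packing_measure0 FG _ => i.
by apply: (le_lt_trans (Gb i)); rewrite lte_fin ltrDl.
Qed.

Lemma mod_gen_upper_box_dim_le F : (mod_gen_upper_box_dim F <= packing_dim F)%E.
Proof.
apply: le_ereal_inf_tmp => _ [s [s0 Fs0] <-].
have /ereal_inf_lt[_ [G FG <-] Gfin] : (packing_measure s F < +oo)%E.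
  by rewrite Fs0.
apply: (@le_trans _ _ (ereal_sup (range (fun i => gen_upper_box_dim (G i))))).
  by apply: ereal_inf_lbound; exists G.
apply: ge_ereal_sup => _ [i _ <-].
have : (packing_premeasure s (G i) < +oo)%E.
  rewrite ltey; apply/eqP => Gi; move: Gfin.
  rewrite (@nneseries_pinfty _ _ predT i)// => k _.
  exact: packing_premeasure_ge0.
move=> /packing_premeasure_lt[delta delta0 Gdelta].
have [C C0 GC] := packing_delta_covered s0 delta0 Gdelta.
exact: covered_gen_upper_box_dim s0 C0 GC.
Qed.

End Comparison.

Theorem proposition3p13 (R : realType) (d : nat) (F : set 'rV[R]_d) :
  packing_dim F = mod_gen_upper_box_dim F.
Proof.
by apply/eqP; rewrite eq_le packing_dim_le mod_gen_upper_box_dim_le.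
Qed.
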